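(* Let $F_L(z)=D_L+C_L(zI_n-A_L)^{-1}B_L$ be a $p\times p$-valued rational function of McMillan degree $n$ and let $F_R(z)=D_R+C_R(zI_m-A_R)^{-1}B_R$ be a $q\times q$-valued rational function of McMillan degree $m$, both given by minimal realizations. Assume that: (i) the $n\times n$ matrix $A_L$ is diagonalizable; (ii) the eigenvalues of $A_L$ (including multiplicity), denoted by $a_1,\dots,a_n\in\mathbb{C}$, are such that the $q\times q$ matrices $$\Delta_j:=D_R-a_jI_q,\qquad j=1,\dots,n,$$ are all non-singular. Then in each of the three following cases of composition $F_L(F_R)$ one obtains a realization $$F_L(F_R(z))=C_{\rm comp}(zI_k-A_{\rm comp})^{-1}B_{\rm comp}+D_{\rm comp},$$ where $k=mn$ and $$A_{\rm comp}={\rm diag}\left(A_R-B_R\Delta_1^{-1}C_R,\ \dots,\ A_R-B_R\Delta_n^{-1}C_R\right)\quad\text{(block diagonal)},\qquad D_{\rm comp}=D_L+\sum_{j=1}^nC_j\Delta_j^{-1}B_j.$$ (I) If $q=n$, i.e. $F_R$ is $n\times n$-valued, then $$B_{\rm comp}=-\begin{pmatrix}B_R\Delta_1^{-1}B_1\\ \vdots\\ B_R\Delta_n^{-1}B_n\end{pmatrix},\qquad C_{\rm comp}=\begin{pmatrix}C_1\Delta_1^{-1}C_R&\cdots&C_n\Delta_n^{-1}C_R\end{pmatrix}.$$ (II) If $q=p$, i.e. both $F_L$ and $F_R$ are $p\times p$-valued, then $$B_{\rm comp}=-\begin{pmatrix}B_R\Delta_1^{-1}C_1B_1\\ \vdots\\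 B_R\Delta_n^{-1}C_nB_n\end{pmatrix},\qquad C_{\rm comp}=\begin{pmatrix}\Delta_1^{-1}C_R&\cdots&\Delta_n^{-1}C_R\end{pmatrix},$$ or $$B_{\rm comp}=-\begin{pmatrix}B_R\Delta_1^{-1}\\ \vdots\\ B_R\Delta_n^{-1}\end{pmatrix},\qquad C_{\rm comp}=\begin{pmatrix}C_1B_1\Delta_1^{-1}C_R&\cdots&C_nB_n\Delta_n^{-1}C_R\end{pmatrix}.$$ (III) If $p=1$, i.e. $F_L=f_L$ is scalar-valued, and $F_R$ is $q\times q$-valued where $q$ is a parameter, define the $n$ scalars $\eta_j:=C_jB_j$, $j=1,\dots,n$; then $$B_{\rm comp}=-\begin{pmatrix}B_R\Delta_1^{-1}\\ \vdots\\ B_R\Delta_n^{-1}\end{pmatrix},\qquad C_{\rm comp}=\begin{pmatrix}\eta_1\Delta_1^{-1}C_R&\cdots&\eta_n\Delta_n^{-1}C_R\end{pmatrix}.$$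
   Context: A realization $F(z)=D+C(zI_n-A)^{-1}B$ of a rational matrix function analytic at infinity is minimal if the size $n$ of $A$ is smallest possible; this $n$ is the McMillan degree of $F$. The matrices $B_j,C_j$ are as follows: since $A_L$ is diagonalizable there are rank-one (oblique) projections $\Pi_1,\dots,\Pi_n\in\mathbb{C}^{n\times n}$ with $\Pi_j\Pi_k=0$ for $j\neq k$, $\sum_{j=1}^n\Pi_j=I_n$ and $A_L=\sum_{j=1}^na_j\Pi_j$; put $B_j:=\Pi_jB_L$ ($n\times p$) and $C_j:=C_L\Pi_j$ ($p\times n$), so that $F_L(z)=D_L+\sum_{j=1}^nC_j(z-a_j)^{-1}B_j=D_L+\sum_{j=1}^n(z-a_j)^{-1}C_jB_j=D_L+\sum_{j=1}^nC_jB_j(z-a_j)^{-1}$. The composition is understood as $F_L(F_R)=D_L+\sum_{j=1}^n\gamma_j(F_R-a_jI_q)^{-1}\beta_j$, where $(\beta_j,\gamma_j)=(B_j,C_j)$ in case (I); $(\beta_j,\gamma_j)=(C_jB_j,1)$ for the first alternative and $(1,C_jB_j)$ for the second alternative in case (II); and $(\beta_j,\gamma_j)=(1,\eta_j)$ in case (III).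
   Formalization: The printed D_comp has incompatible sizes outside case (I); it is replaced in (II) by D_L + Σ Δ_j^{-1}C_jB_j, resp. D_L + Σ C_jB_jΔ_j^{-1}, and in (III) by D_L I_q + Σ η_jΔ_j^{-1}. *)

(* Defs.v *)
From mathcomp Require Import all_boot all_order all_algebra all_fingroup.
From mathcomp Require Import reals complex.

Set Implicit Arguments.
Unset Strict Implicit.
Unset Printing Implicit Defensive.

Import GRing.Theory.
Local Open Scope ring_scope.

(* A p x q rational matrix function over K is a matrix over the fraction field
   of {poly K}, and identities between rational functions are equalities in
   that field. *)
Notation ratfun K := {fraction {poly K}}.

Definition ratcst {K : fieldType} (c : K) : ratfun K := tofrac c%:P.

Definition ratz {K : fieldType} : ratfun K := tofrac 'X.

(* D + C (z I_n - A)^-1 B.  The matrix z I_n - A is always invertible over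
   ratfun K, its determinant being the characteristic polynomial of A, so the
   default value of invmx on singular matrices is never used. *)
Definition transfer (K : fieldType) (n p q : nat) (A : 'M[K]_n)
    (B : 'M[K]_(n, q)) (C : 'M[K]_(p, n)) (D : 'M[K]_(p, q)) :
    'M[ratfun K]_(p, q) :=
  map_mx ratcst D +
  map_mx ratcst C *m invmx (ratz%:M - map_mx ratcst A) *m map_mx ratcst B.

Definition realization (K : fieldType) (n p q : nat)
    (F : 'M[ratfun K]_(p, q)) (A : 'M[K]_n) (B : 'M[K]_(n, q))
    (C : 'M[K]_(p, n)) (D : 'M[K]_(p, q)) : Prop :=
  F = transfer A B C D.

Definition minimal_realization (K : fieldType) (n p q : nat)
    (F : 'M[ratfun K]_(p, q)) (A : 'M[K]_n) (B : 'M[K]_(n, q))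
    (C : 'M[K]_(p, n)) (D : 'M[K]_(p, q)) : Prop :=
  realization F A B C D /\
  forall (n' : nat) (A' : 'M[K]_n') (B' : 'M[K]_(n', q))
    (C' : 'M[K]_(p, n')) (D' : 'M[K]_(p, q)),
    realization F A' B' C' D' -> (n <= n')%N.

Definition mcmillan_degree (K : fieldType) (p q : nat)
    (F : 'M[ratfun K]_(p, q)) (n : nat) : Prop :=
  exists (A : 'M[K]_n) (B : 'M[K]_(n, q)) (C : 'M[K]_(p, n))
    (D : 'M[K]_(p, q)), minimal_realization F A B C D.

Definition spectral_decomposition (K : fieldType) (n : nat) (A : 'M[K]_n)
    (a : 'I_n -> K) (P : 'I_n -> 'M[K]_n) : Prop :=
  [/\ forall j, \rank (P j) = 1%N /\ P j *m P j = P j,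
      forall j k, j != k -> P j *m P k = 0,
      \sum_j P j = 1%:M
    & A = \sum_j a j *: P j].

Lemma spectral_decomposition_exists (K : fieldType) (n : nat) (A : 'M[K]_n)
    (a : 'I_n -> K) :
  diagonalizable A -> char_poly A = \prod_(j < n) ('X - (a j)%:P) ->
  exists P : 'I_n -> 'M[K]_n, spectral_decomposition A a P.
Proof.
move=> [Q Qu /similar_diagPex[d /(similarLR Qu) AE]] charA.
rewrite conjVmx// in AE.
have charAd : char_poly A = \prod_(j < n) ('X - (d 0 j)%:P).
  have : char_poly A = char_poly (diag_mx d).
    rewrite /char_poly /char_poly_mx AE !map_mxM /= map_invmx.
    set S := map_mx _ Q; set T := map_mx _ (diag_mx d).
    have Su : S \in unitmx by rewrite map_unitmx.
    have -> : 'X%:M - invmx S *m T *m S = invmx S *m ('X%:M - T) *m S.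
      by rewrite mulmxBr mulmxBl scalar_mxC mulmxKV.
    by rewrite !det_mulmx det_inv mulrC mulrA divrr ?mul1r// -unitmxE.
  move=> ->; rewrite char_poly_trig ?diag_mx_is_trig//.
  by apply: eq_bigr => j _; rewrite mxE eqxx.
have /tuple_permP[s sE] : perm_eq [tuple a j | j < n] [tuple d 0 j | j < n].
  by apply: prod_XsubC_eq; rewrite !big_map -!enumT !big_enum /= -charA.
have adE j : a j = d 0 (s j).
  move/val_inj/(congr1 (fun t => tnth t j)): sE.
  by rewrite !tnth_mktuple.
pose P j := invmx Q *m delta_mx (s j) (s j) *m Q.
have PM j k : P j *m P k = invmx Q *m (delta_mx (s j) (s j) *m delta_mx (s k) (s k)) *m Q.
  by rewrite /P !mulmxA mulmxK.
exists P; split.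
- move=> j; split; last by rewrite PM mul_delta_mx.
  by rewrite /P mxrankMfree ?row_free_unit// eqmxMfull ?row_full_unit ?unitmx_inv// mxrank_delta.
- move=> j k jk; rewrite PM mul_delta_mx_0 ?mulmx0 ?mul0mx//.
  by rewrite (inj_eq perm_inj).
- rewrite -mulmx_suml -mulmx_sumr.
  have -> : \sum_j delta_mx (s j) (s j) = 1%:M :> 'M[K]_n.
    by rewrite mx1_sum_delta [RHS](reindex_perm s).
  by rewrite mulmx1 mulVmx.
- rewrite AE diag_mx_sum_delta (reindex_perm s) /=.
  rewrite mulmx_sumr mulmx_suml; apply: eq_bigr => j _.
  by rewrite -scalemxAr -scalemxAl adE.
Qed.

(* The composition D + sum_j gamma_j (F - a_j I_q)^-1 beta_j. *)
Definition composition (K : fieldType) (n q r : nat) (D : 'M[K]_r)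
    (a : 'I_n -> K) (beta : 'I_n -> 'M[K]_(q, r))
    (gamma : 'I_n -> 'M[K]_(r, q)) (F : 'M[ratfun K]_q) : 'M[ratfun K]_r :=
  map_mx ratcst D +
  \sum_(j < n) map_mx ratcst (gamma j) *m
    invmx (F - (ratcst (a j))%:M) *m map_mx ratcst (beta j).

(* Main.v *)
Require Import Defs.
From HB Require Import structures.
From mathcomp Require Import all_boot all_order all_algebra all_fingroup.
From mathcomp Require Import reals complex.

Import GRing.Theory.
Local Open Scope ring_scope.

(** Since [F_R - a_j] is realized by [(A_R, B_R, C_R, Delta_j)] and [Delta_j] is
    invertible, the Sherman-Morrison-Woodbury formula realizes its inverse with
    state matrix [A_R - B_R Delta_j^-1 C_R].  Multiplying by the constants
    [gamma_j] and [beta_j] and summing over [j] puts these realizations in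
    parallel, which gives a block diagonal state matrix.  The three cases are
    choices of [beta] and [gamma]. *)

(** [ratcst] is convertible to the composite of [polyC] and [tofrac], so it inherits their morphism
    structure. This lets [map_mx ratcst] commute with sums, products and inverses. *)
HB.instance Definition _ (K : fieldType) :=
  GRing.RMorphism.copy (@ratcst K) (@tofrac {poly K} \o polyC).

(** The cross terms cancel by the resolvent identity [Z^-1 (W - Z) W^-1 = Z^-1 - W^-1], where
    [W - Z = B D^-1 C]. *)
Lemma mulmx_woodbury (F : fieldType) (m q : nat) (Z : 'M[F]_m)
    (B : 'M[F]_(m, q)) (C : 'M[F]_(q, m)) (D : 'M[F]_q) :
  let W := Z + B *m invmx D *m C in
  Z \in unitmx -> D \in unitmx -> W \in unitmx ->
  (D + C *m invmx Z *m B) *m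
    (invmx D + (- (invmx D *m C)) *m invmx W *m (B *m invmx D)) = 1%:M.
Proof.
move=> W Zu Du Wu.
have key : invmx Z *m (B *m invmx D *m C) *m invmx W = invmx Z - invmx W.
  have -> : B *m invmx D *m C = W - Z by rewrite /W addrC addKr.
  by rewrite mulmxBr mulmxBl mulmxK// mulVmx// mul1mx.
rewrite !mulNmx mulmxBr !mulmxDl mulmxV// !mulmxA mulmxV// mul1mx.
have -> : C *m invmx Z *m B *m invmx D *m C *m invmx W *m B *m invmx D =
    C *m (invmx Z *m (B *m invmx D *m C) *m invmx W) *m B *m invmx D.
  by rewrite !mulmxA.
by rewrite key mulmxBr !mulmxBl addrCA subrr addr0 addrK.
Qed.

(** The determinant is the image of the characteristic polynomial, which is monic, hence nonzero in
    the fraction field. *)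
Lemma resolvent_unit {K : fieldType} {n : nat} (A : 'M[K]_n) :
  Defs.ratz%:M - map_mx ratcst A \in unitmx.
Proof.
have -> : Defs.ratz%:M - map_mx ratcst A = map_mx (@tofrac {poly K})
    (char_poly_mx A).
  by rewrite /char_poly_mx map_mxB /= map_scalar_mx -map_mx_comp.
rewrite unitmxE det_map_mx unitfE tofrac_eq0.
exact/monic_neq0/char_poly_monic.
Qed.

Lemma transfer_subr_scalar (K : fieldType) (m q : nat) (A : 'M[K]_m)
    (B : 'M[K]_(m, q)) (C : 'M[K]_(q, m)) (D : 'M[K]_q) (c : K) :
  transfer A B C D - (ratcst c)%:M = transfer A B C (D - c%:M).
Proof. by rewrite /transfer map_mxB /= map_scalar_mx addrAC. Qed.

(** Woodbury with [Z = z - A]: then [W = z - (A - B D^-1 C)] is again of the form covered by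
    [resolvent_unit], so only [D] has to be assumed invertible. *)
Lemma mulmx_transfer_inv {K : fieldType} {m q : nat} (A : 'M[K]_m)
    (B : 'M[K]_(m, q)) (C : 'M[K]_(q, m)) {D : 'M[K]_q} :
  D \in unitmx ->
  transfer A B C D *m
    transfer (A - B *m invmx D *m C) (B *m invmx D) (- (invmx D *m C))
      (invmx D) = 1%:M.
Proof.
move=> Du; have := resolvent_unit (A - B *m invmx D *m C).
rewrite /transfer map_mxB map_mxN !map_mxM map_invmx opprB addrCA
  [_ + (_ - _)]addrC => Wu.
have Du' : map_mx ratcst D \in unitmx by rewrite map_unitmx.
exact: mulmx_woodbury (resolvent_unit A) Du' Wu.
Qed.

Lemma invmx_mulmx1 {R : comUnitRingType} {n : nat} {A B : 'M[R]_n} :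
  A *m B = 1%:M -> invmx A = B.
Proof.
move=> AB; have [Au _] := mulmx1_unit AB.
by rewrite -[B](mulKmx Au) AB mulmx1.
Qed.

Lemma invmx_mxdiag (R : comUnitRingType) (n m : nat) (A : 'I_n -> 'M[R]_m) :
  (forall j, A j \in unitmx) ->
  invmx (\mxdiag_(j < n) A j) = \mxdiag_(j < n) invmx (A j).
Proof.
move=> Au; apply: invmx_mulmx1; rewrite [X in _ *m X]/mxdiag mul_mxdiag_mxblock.
rewrite -mxdiagZ /mxdiag; apply: eq_mxblock => i j.
(* Diagonal blocks of [mxdiag] are wrapped in the cast [conform_mx], trivial here since all blocks
   have size [m]. *)
by case: eqVneq => _; rewrite ?conform_mx_id ?mulmxV ?mulmx0.
Qed.

Lemma map_mxdiag {K L : fieldType} (f : {rmorphism K -> L}) (n m : nat)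
    (A : 'I_n -> 'M[K]_m) :
  map_mx f (\mxdiag_(j < n) A j) = \mxdiag_(j < n) map_mx f (A j).
Proof.
apply/matrixP => i j; rewrite !mxE.
by case: eqVneq => [e|_]; rewrite ?mxE ?rmorph0// !conform_mx_id mxE.
Qed.

(** Parallel connection: the resolvent of a block diagonal matrix is block diagonal, and row times
    diagonal times column is a sum over blocks. The constant [D] is kept apart to match the leading
    term of [composition]. *)
Lemma transfer_mxdiag (K : fieldType) (n m p q : nat) (A : 'I_n -> 'M[K]_m)
    (B : 'I_n -> 'M[K]_(m, q)) (C : 'I_n -> 'M[K]_(p, m)) (D : 'M[K]_(p, q))
    (E : 'I_n -> 'M[K]_(p, q)) :
  transfer (\mxdiag_j A j) (\mxcol_j B j) (\mxrow_j C j) (D + \sum_j E j) =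
  map_mx ratcst D + \sum_j transfer (A j) (B j) (C j) (E j).
Proof.
rewrite /transfer map_mxD raddf_sum -addrA big_split /=; congr (_ + (_ + _)).
have -> : map_mx ratcst (\mxcol_j B j) = \mxcol_j map_mx ratcst (B j).
  by apply/matrixP => i j; rewrite !mxE.
have -> : map_mx ratcst (\mxrow_j C j) = \mxrow_j map_mx ratcst (C j).
  by apply/matrixP => i j; rewrite !mxE.
rewrite map_mxdiag -mxdiagZ -mxdiagB invmx_mxdiag => [|j].
  by rewrite mul_mxrow_mxdiag mul_mxrow_mxcol.
exact: resolvent_unit.
Qed.

Lemma mulmx_transfer (K : fieldType) (m p q r s : nat) (A : 'M[K]_m)
    (B : 'M[K]_(m, q)) (C : 'M[K]_(p, m)) (D : 'M[K]_(p, q))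
    (G : 'M[K]_(r, p)) (H : 'M[K]_(q, s)) :
  map_mx ratcst G *m transfer A B C D *m map_mx ratcst H =
  transfer A (B *m H) (G *m C) (G *m D *m H).
Proof. by rewrite /transfer !map_mxM mulmxDr mulmxDl !mulmxA. Qed.

(** The inverse realization carries its minus sign on the output matrix, whereas [B_comp] carries it
    on the input side. *)
Lemma transfer_opp_swap (K : fieldType) (n p q : nat) (A : 'M[K]_n)
    (B : 'M[K]_(n, q)) (C : 'M[K]_(p, n)) (D : 'M[K]_(p, q)) :
  transfer A (- B) C D = transfer A B (- C) D.
Proof. by rewrite /transfer !map_mxN mulmxN !mulNmx. Qed.

Section Composition.
Context {K : fieldType} {m q : nat} {F : 'M[ratfun K]_q} {A : 'M[K]_m}.
Context {B : 'M[K]_(m, q)} {C : 'M[K]_(q, m)} {D : 'M[K]_q}.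
Hypothesis realF : realization F A B C D.

(** This guarantees that the inverses in [composition] are genuine, not the default value of
    [invmx]. *)
Lemma realization_subr_scalar_unit (c : K) :
  D - c%:M \in unitmx -> F - (ratcst c)%:M \in unitmx.
Proof.
rewrite realF transfer_subr_scalar => Du.
have [Fu _] := mulmx1_unit (mulmx_transfer_inv A B C Du).
exact: Fu.
Qed.

(** The size [r] is independent of [q], so as to cover all cases: it is [p] in (I) and (II), and [q]
    in (III). *)
Lemma realization_composition {n r : nat} (D0 : 'M[K]_r) (a : 'I_n -> K)
    (beta : 'I_n -> 'M[K]_(q, r)) (gamma : 'I_n -> 'M[K]_(r, q)) :
  let Delta := fun j => D - (a j)%:M in
  (forall j, Delta j \in unitmx) ->
  realization (composition D0 a beta gamma F)
    (\mxdiag_(j < n) (A - B *m invmx (Delta j) *m C))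
    (- \mxcol_(j < n) (B *m invmx (Delta j) *m beta j))
    (\mxrow_(j < n) (gamma j *m invmx (Delta j) *m C))
    (D0 + \sum_(j < n) gamma j *m invmx (Delta j) *m beta j).
Proof.
move=> Delta Du; rewrite /realization /composition -mxcolN transfer_mxdiag.
congr (_ + _); apply: eq_bigr => j _; rewrite realF transfer_subr_scalar.
rewrite (invmx_mulmx1 (mulmx_transfer_inv A B C (Du j))).
by rewrite mulmx_transfer transfer_opp_swap mulmxN mulmxA.
Qed.

End Composition.

Theorem proposition3p6 (R : realType) (p n : nat)
  (FL : 'M[ratfun R[i]]_p)
  (AL : 'M[R[i]]_n) (BL : 'M[R[i]]_(n, p))
  (CL : 'M[R[i]]_(p, n)) (DL : 'M[R[i]]_p)
  (a : 'I_n -> R[i]) (Pi : 'I_n -> 'M[R[i]]_n)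
  (degFL : mcmillan_degree FL n)
  (minFL : minimal_realization FL AL BL CL DL)
  (diagAL : diagonalizable AL)
  (eigAL : char_poly AL = \prod_(j < n) ('X - (a j)%:P))
  (specAL : spectral_decomposition AL a Pi) :
  let B := fun j : 'I_n => Pi j *m BL in
  let C := fun j : 'I_n => CL *m Pi j in
  [/\ (* case (I): q = n *)
    forall (m : nat) (FR : 'M[ratfun R[i]]_n)
      (AR : 'M[R[i]]_m) (BR : 'M[R[i]]_(m, n))
      (CR : 'M[R[i]]_(n, m)) (DR : 'M[R[i]]_n),
      mcmillan_degree FR m ->
      minimal_realization FR AR BR CR DR ->
      let Delta := fun j : 'I_n => DR - (a j)%:M in
      (forall j, Delta j \in unitmx) ->
      [/\ (\sum_(j < n) m)%N = (m * n)%N,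
          forall j, FR - (ratcst (a j))%:M \in unitmx
        & realization (composition DL a B C FR)
            (\mxdiag_(j < n) (AR - BR *m invmx (Delta j) *m CR))
            (- \mxcol_(j < n) (BR *m invmx (Delta j) *m B j))
            (\mxrow_(j < n) (C j *m invmx (Delta j) *m CR))
            (DL + \sum_(j < n) C j *m invmx (Delta j) *m B j)],
    (* case (II): q = p *)
    forall (m : nat) (FR : 'M[ratfun R[i]]_p)
      (AR : 'M[R[i]]_m) (BR : 'M[R[i]]_(m, p))
      (CR : 'M[R[i]]_(p, m)) (DR : 'M[R[i]]_p),
      mcmillan_degree FR m ->
      minimal_realization FR AR BR CR DR ->
      let Delta := fun j : 'I_n => DR - (a j)%:M in
      (forall j, Delta j \in unitmx) ->
      [/\ (\sum_(j < n) m)%N = (m * n)%N,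
          forall j, FR - (ratcst (a j))%:M \in unitmx,
          realization
            (composition DL a (fun j => C j *m B j) (fun=> 1%:M) FR)
            (\mxdiag_(j < n) (AR - BR *m invmx (Delta j) *m CR))
            (- \mxcol_(j < n) (BR *m invmx (Delta j) *m (C j *m B j)))
            (\mxrow_(j < n) (invmx (Delta j) *m CR))
            (DL + \sum_(j < n) invmx (Delta j) *m (C j *m B j))
        & realization
            (composition DL a (fun=> 1%:M) (fun j => C j *m B j) FR)
            (\mxdiag_(j < n) (AR - BR *m invmx (Delta j) *m CR))
            (- \mxcol_(j < n) (BR *m invmx (Delta j)))
            (\mxrow_(j < n) (C j *m B j *m invmx (Delta j) *m CR))
            (DL + \sum_(j < n) C j *m B j *m invmx (Delta j))]
  & (* case (III): p = 1; i0 is then the only index, and the 1 x 1 matrices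
       C j *m B j and DL are identified with their entry *)
    p = 1%N -> forall i0 : 'I_p,
    let eta := fun j : 'I_n => (C j *m B j) i0 i0 in
    let dL := DL i0 i0 in
    forall (q m : nat) (FR : 'M[ratfun R[i]]_q)
      (AR : 'M[R[i]]_m) (BR : 'M[R[i]]_(m, q))
      (CR : 'M[R[i]]_(q, m)) (DR : 'M[R[i]]_q),
      mcmillan_degree FR m ->
      minimal_realization FR AR BR CR DR ->
      let Delta := fun j : 'I_n => DR - (a j)%:M in
      (forall j, Delta j \in unitmx) ->
      [/\ (\sum_(j < n) m)%N = (m * n)%N,
          forall j, FR - (ratcst (a j))%:M \in unitmx
        & realization
            (composition dL%:M a (fun=> 1%:M) (fun j => (eta j)%:M) FR)
            (\mxdiag_(j < n) (AR - BR *m invmx (Delta j) *m CR))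
            (- \mxcol_(j < n) (BR *m invmx (Delta j)))
            (\mxrow_(j < n) (eta j *: (invmx (Delta j) *m CR)))
            (dL%:M + \sum_(j < n) eta j *: invmx (Delta j))]].
Proof.
(* The block matrices are indexed by this iterated sum; it is the state dimension [k]. *)
have sumE m : (\sum_(j < n) m)%N = (m * n)%N.
  by rewrite sum_nat_const card_ord mulnC.
move=> B C; split.
- move=> m FR AR BR CR DR _ [realR _] Delta Du; split=> // [j|].
    exact: realization_subr_scalar_unit realR _ (Du j).
  exact: realization_composition.
- move=> m FR AR BR CR DR _ [realR _] Delta Du; split=> // [j||].
  + exact: realization_subr_scalar_unit realR _ (Du j).
  (* A realization is an equation, so rewriting leaves two transfer functions that differ only by
     identity factors. *)
  + rewrite (realization_composition realR DL a (fun j => C j *m B j)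
      (fun=> 1%:M) Du).
    congr (transfer _ _ _ (_ + _)); first by apply: eq_mxrow => j; rewrite mul1mx.
    by apply: eq_bigr => j _; rewrite mul1mx.
  + rewrite (realization_composition realR DL a (fun=> 1%:M)
      (fun j => C j *m B j) Du).
    congr (transfer _ (- _) _ (_ + _)).
      by apply: eq_mxcol => j; rewrite mulmx1.
    by apply: eq_bigr => j _; rewrite mulmx1.
- move=> _ i0 eta dL q m FR AR BR CR DR _ [realR _] Delta Du; split=> // [j|].
    exact: realization_subr_scalar_unit realR _ (Du j).
  (* The scalars [eta j] enter as scalar [q x q] matrices, whose products reduce to scalings. *)
  rewrite (realization_composition realR dL%:M a (fun=> 1%:M)
    (fun j => (eta j)%:M) Du).
  congr (transfer _ (- _) _ (_ + _)).
  + by apply: eq_mxcol => j; rewrite mulmx1.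
  + by apply: eq_mxrow => j; rewrite -mulmxA mul_scalar_mx.
  + by apply: eq_bigr => j _; rewrite mulmx1 mul_scalar_mx.
Qed.
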